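(* Let $\Lambda,\Lambda'\in\mathbf{\Lambda}_r$ with $\Lambda'\subset\Lambda$, and let $\mathbf{t}=(t_g)_{g\in\Lambda}$, $\mathbf{t}'=(t_g)_{g\in\Lambda'}$. Then $$\Bigl(\prod_{g\in\Lambda\setminus\Lambda'}D_g\Bigr)F(\mathbf{t},\mathbf{y};\Lambda)=F(\mathbf{t}',\mathbf{y};\Lambda'),$$ where on the left-hand side the operators $D_g$ act at $\mathbf{y}\in V\setminus\mathfrak{H}_{\mathscr{R}(\Lambda)}$ and the resulting function is continuously extended to all $\mathbf{y}\in V$ by the one-sided limit along $\phi$ (i.e. its value at $\mathbf{y}$ is the limit as $c\to0+$ of its value at $\mathbf{y}+c\phi$).
   Context: $V=\mathbb{R}^r$ with standard inner product $\langle\cdot,\cdot\rangle$. Let $\mathbf{\Lambda}_r$ be the family of finite sets $\Lambda\subset(\mathbb{Z}^r\setminus\{0\})\times\mathbb{C}$ such that the $\mathbb{Z}$-module generated by $\{\vec f:f\in\Lambda\}$ has rank $r$; elements are written $f=(\vec f,b_f)$. For such $\Lambda$: $\mathscr{B}(\Lambda)$ is the set of subsets $B\subset\Lambda$ with $r$ elements whose vectors form a basis of $V$; $\vec f^B$ ($f\in B$) the dual basis ($\langle\vec g,\vec f^B\rangle=\delta_{gf}$); $\langle\vec B\rangle=\sum_{f\in B}\mathbb{Z}\vec f$. $\mathscr{R}(\Lambda)$ is the set of subsets $R\subset\Lambda$ with $r-1$ elements whose vectors are linearly independent, $\mathfrak{H}_R=\sum_{g\in R}\mathbb{R}\vec g$,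 $\mathfrak{H}_{\mathscr{R}(\Lambda)}=\bigcup_{R\in\mathscr{R}(\Lambda)}(\mathfrak{H}_R+\mathbb{Z}^r)$. A vector $\phi\in V\setminus\bigcup_{R\in\mathscr{R}(\Lambda)}\mathfrak{H}_R$ is fixed (used for both $\Lambda$ and $\Lambda'$). $\{\mathbf{y}\}_{B,f}=\{\langle\mathbf{y},\vec f^B\rangle\}$ if $\langle\phi,\vec f^B\rangle>0$ and $=1-\{-\langle\mathbf{y},\vec f^B\rangle\}$ if $<0$, with $\{a\}=a-\lfloor a\rfloor$. Define $$F(\mathbf{t},\mathbf{y};\Lambda)=\sum_{B\in\mathscr{B}(\Lambda)}\Bigl(\prod_{g\in\Lambda\setminus B}\frac{t_g}{t_g-2\pi\sqrt{-1}b_g-\sum_{f\in B}(t_f-2\pi\sqrt{-1}b_f)\langle\vec g,\vec f^B\rangle}\Bigr)\frac{1}{\sharp(\mathbb{Z}^r/\langle\vec B\rangle)}\sum_{\mathbf{w}\in\mathbb{Z}^r/\langle\vec B\rangle}\prod_{f\in B}\frac{t_fe^{(t_f-2\pi\sqrt{-1}b_f)\{\mathbf{y}+\mathbf{w}\}_{B,f}}}{e^{t_f-2\pi\sqrt{-1}b_f}-1}.$$ For $\mathbf{v}=(v_1,\dots,v_r)\in V$ put $\partial_{\mathbf{v}}=v_1\partial_{y_1}+\cdots+v_r\partial_{y_r}$ (derivatives in $\mathbf{y}=(y_1,\dots,y_r)$), and for $g=(\vec g,b_g)$ put $D_g=\frac{t_g-2\pi\sqrt{-1}b_g}{t_g}-\frac{1}{t_g}\partial_{\vec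 g}$. *)

(* Defs.v *)
From HB Require Import structures.
From mathcomp Require Import all_boot all_order all_algebra.
From mathcomp Require Import finmap.
From mathcomp Require Import all_classical all_reals all_analysis.
From mathcomp Require Import complex.

Set Implicit Arguments.
Unset Strict Implicit.
Unset Printing Implicit Defensive.

Import Order.TTheory GRing.Theory Num.Theory.
Import numFieldNormedType.Exports.

Local Open Scope fset_scope.
Local Open Scope classical_set_scope.
Local Open Scope complex_scope.
Local Open Scope ring_scope.

Definition cexp (R : realType) (z : R[i]) : R[i] :=
  (expR (complex.Re z))%:C * (cos (complex.Im z) +i* sin (complex.Im z)).

Definition frac (R : realType) (a : R) : R := a - (Num.floor a)%:~R.

Definition dotp (R : realType) (r : nat) (x y : 'rV[R]_r) : R :=
  \sum_(i < r) x 0 i * y 0 i.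

(* An element f is the pair (vector of f, b_f). *)
Definition elt (R : realType) (r : nat) : choiceType :=
  ('rV[int]_r * R[i])%type.

Definition toV (R : realType) (r : nat) (w : 'rV[int]_r) : 'rV[R]_r :=
  map_mx intr w.

Definition vec (R : realType) (r : nat) (f : elt R r) : 'rV[R]_r := toV R f.1.

Definition vecs (R : realType) (r : nat) (A : {fset elt R r}) :
  seq 'rV[R]_r := [seq vec f | f <- enum_fset A].

(* The rank of the submodule of Z^r generated by the vectors of A, as the
   dimension over Q of the subspace of Q^r it spans. *)
Definition lattice_rank (R : realType) (r : nat) (A : {fset elt R r}) : nat :=
  \dim <<[seq map_mx intr f.1 : 'rV[rat]_r | f : elt R r <- enum_fset A]>>%VS.

(* The family Lambda_r. *)
Definition admissible (R : realType) (r : nat) (L : {fset elt R r}) : Prop :=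
  (forall f, f \in L -> f.1 != 0) /\ lattice_rank L = r.

(* The set B(Lambda). *)
Definition bases (R : realType) (r : nat) (L : {fset elt R r}) :
    {fset {fset elt R r}} :=
  [fset B in fpowerset L | (#|` B| == r) && basis_of fullv (vecs B)].

(* The set R(Lambda); the condition #|R| = r - 1 is written #|R| + 1 = r. *)
Definition walls (R : realType) (r : nat) (L : {fset elt R r}) :
    {fset {fset elt R r}} :=
  [fset S in fpowerset L | (#|` S|.+1 == r) && free (vecs S)].

(* The union of the hyperplanes H_R translated by Z^r. *)
Definition hyperplanes (R : realType) (r : nat) (L : {fset elt R r}) :
    set 'rV[R]_r :=
  [set y | exists S : {fset elt R r}, exists w : 'rV[int]_r,
     S \in walls L /\ y - toV R w \in <<vecs S>>%VS].

Definition phi_regular (R : realType) (r : nat) (L : {fset elt R r})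
    (phi : 'rV[R]_r) : Prop :=
  forall S, S \in walls L -> phi \notin <<vecs S>>%VS.

(* The element f^B of the dual basis, unique when B is a basis and f \in B. *)
Definition dual (R : realType) (r : nat) (B : {fset elt R r}) (f : elt R r) :
    'rV[R]_r :=
  xget 0 [set v | forall g, g \in B -> dotp (vec g) v = (g == f)%:R].

Definition lattice (R : realType) (r : nat) (B : {fset elt R r}) :
    set 'rV[int]_r :=
  [set w | exists c : elt R r -> int, w = \sum_(f <- enum_fset B) c f *: f.1].

(* Z^r / <B> as a set of cosets; fset_set is the fset of its elements, the
   quotient being finite when B is a basis. *)
Definition lquot (R : realType) (r : nat) (B : {fset elt R r}) :
    {fset set 'rV[int]_r} :=
  fset_set [set C | exists w : 'rV[int]_r,
                      C = [set w' | lattice B (w' - w)]].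

(* Some representative of a coset. *)
Definition coset_rep (r : nat) (C : set 'rV[int]_r) : 'rV[int]_r := xget 0 C.

(* {y}_{B,f}; <phi, f^B> is nonzero when phi_regular holds. *)
Definition fracB (R : realType) (r : nat) (phi : 'rV[R]_r)
    (B : {fset elt R r}) (f : elt R r) (y : 'rV[R]_r) : R :=
  if 0 < dotp phi (dual B f) then frac (dotp y (dual B f))
  else 1 - frac (- dotp y (dual B f)).

(* t_g - 2 pi i b_g *)
Definition tshift (R : realType) (r : nat) (t : elt R r -> R[i]) (g : elt R r) :
    R[i] :=
  t g - (2 * pi)%:C * 'i%C * g.2.

(* The denominator of the factor of g in Lambda minus B. *)
Definition linden (R : realType) (r : nat) (t : elt R r -> R[i])
    (B : {fset elt R r}) (g : elt R r) : R[i] :=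
  tshift t g
  - \sum_(f <- enum_fset B) tshift t f * (dotp (vec g) (dual B f))%:C.

(* F(t, y; Lambda); only the restriction of t to Lambda matters. *)
Definition genF (R : realType) (r : nat) (phi : 'rV[R]_r)
    (L : {fset elt R r}) (t : elt R r -> R[i]) (y : 'rV[R]_r) : R[i] :=
  \sum_(B <- enum_fset (bases L))
    (\prod_(g <- enum_fset (L `\` B)%fset) (t g / linden t B g))
    * ((#|` lquot B|)%:R^-1
       * \sum_(C <- enum_fset (lquot B))
           \prod_(f <- enum_fset B)
             (t f * cexp (tshift t f
                          * (fracB phi B f (y + toV R (coset_rep C)))%:C)
              / (cexp (tshift t f) - 1))).

(* t is off the zero loci of the denominators in F(t, y; Lambda). *)
Definition t_regular (R : realType) (r : nat) (L : {fset elt R r})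
    (t : elt R r -> R[i]) : Prop :=
  (forall f, f \in L -> cexp (tshift t f) - 1 != 0) /\
  (forall B g, B \in bases L -> g \in (L `\` B)%fset -> linden t B g != 0).

(* Partial derivatives of a complex-valued function of a real vector, taken on
   the real and imaginary parts. *)
Definition pderivable (R : realType) (r : nat) (h : 'rV[R]_r -> R[i])
    (y : 'rV[R]_r) (j : 'I_r) : Prop :=
  derivable (fun x => complex.Re (h x)) y (delta_mx 0 j) /\
  derivable (fun x => complex.Im (h x)) y (delta_mx 0 j).

Definition pderiv (R : realType) (r : nat) (j : 'I_r) (h : 'rV[R]_r -> R[i])
    (y : 'rV[R]_r) : R[i] :=
  'D_(delta_mx 0 j) (fun x => complex.Re (h x)) y
  +i* 'D_(delta_mx 0 j) (fun x => complex.Im (h x)) y.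

Definition partial (R : realType) (r : nat) (v : 'rV[R]_r)
    (h : 'rV[R]_r -> R[i]) (y : 'rV[R]_r) : R[i] :=
  \sum_(j < r) (v 0 j)%:C * pderiv j h y.

Definition Dop (R : realType) (r : nat) (t : elt R r -> R[i]) (g : elt R r)
    (h : 'rV[R]_r -> R[i]) (y : 'rV[R]_r) : R[i] :=
  tshift t g / t g * h y - (t g)^-1 * partial (vec g) h y.

(* The composite of the D_g, g in s, the last element of s acting first. *)
Definition Dprod (R : realType) (r : nat) (t : elt R r -> R[i])
    (s : seq (elt R r)) (h : 'rV[R]_r -> R[i]) : 'rV[R]_r -> R[i] :=
  foldr (Dop t) h s.

(* All partial derivatives that occur in Dprod t s h exist on U. *)
Fixpoint Dprod_defined (R : realType) (r : nat) (t : elt R r -> R[i])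
    (U : set 'rV[R]_r) (s : seq (elt R r)) (h : 'rV[R]_r -> R[i]) : Prop :=
  if s is _ :: s' then
    Dprod_defined t U s' h /\
    forall y j, U y -> pderivable (Dprod t s' h) y j
  else True.

(* Main.v *)
Require Import Defs.
From HB Require Import structures.
From mathcomp Require Import all_boot all_order all_algebra.
From mathcomp Require Import finmap.
From mathcomp Require Import all_classical all_reals all_analysis.
From mathcomp Require Import complex.
From mathcomp Require Import ring.

Set Implicit Arguments.
Unset Strict Implicit.
Unset Printing Implicit Defensive.

Import Order.TTheory GRing.Theory Num.Theory.
Import numFieldNormedType.Exports.

Local Open Scope fset_scope.
Local Open Scope classical_set_scope.
Local Open Scope complex_scope.
Local Open Scope ring_scope.

(* Off the walls every fractional part [{y + w}_{B,f}] is affine in [y] with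
   slope [f^B]. The term of a basis [B] in [F] is therefore locally multiplied
   by [cexp (h * sum_f (t_f - 2 pi i b_f) <v, f^B>)] when [y] moves by [h v], so
   [D_g] multiplies it by [linden t B g / t g]. This factor cancels the factor
   of [g] in the product over [L - B], and vanishes when [g] is in [B], which
   leaves exactly the terms of the bases contained in [L']. By the sign
   convention in [fracB], the same exponential behaviour holds at every [y] for
   small positive displacements along [phi], which gives the limit. *)

(** * Sums of complex exponentials of a real variable: derivative at 0 and continuity *)

Section ComplexExponential.
Context {R : realType}.
Implicit Types (a b c z mu : R[i]) (x h : R).

Lemma cexp0 : cexp (0 : R[i]) = 1.
Proof.
by rewrite /cexp /= expR0 cos0 sin0 mul1r; apply/eqP; rewrite eq_complex !eqxx.
Qed.

Lemma cexpD a b : cexp (a + b) = cexp a * cexp b.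
Proof.
case: a b => [a1 a2] [b1 b2]; rewrite /cexp /= expRD cosD sinD.
by apply/eqP; rewrite eq_complex /=; apply/andP; split; apply/eqP; ring.
Qed.

Lemma cexp_sum (I : Type) (s : seq I) (F : I -> R[i]) :
  cexp (\sum_(i <- s) F i) = \prod_(i <- s) cexp (F i).
Proof. exact: (big_morph _ cexpD cexp0). Qed.

(** With [mu = m + i n], the real part expands to [expR (m h) (c1 cos (n h) - c2 sin (n h))], to
    which the real product and chain rules apply. *)
Lemma is_derive_Re_cexp c mu :
  is_derive (0 : R) 1 (fun h => complex.Re (c * cexp (h%:C * mu)))
    (complex.Re (c * mu)).
Proof.
case: c mu => [c1 c2] [m n].
have -> : (fun h => complex.Re ((c1 +i* c2) * cexp (h%:C * (m +i* n)))) =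
   (expR \o (fun h => m * h)) * (fun h => c1 * (cos \o (fun h => n * h)) h
      - c2 * (sin \o (fun h => n * h)) h) :> (R -> R).
  apply/funext => h; rewrite /cexp /=.
  rewrite -[RHS]/(expR (m * h) * (c1 * cos (n * h) - c2 * sin (n * h))).
  have -> : h * m - 0 * n = m * h by ring.
  have -> : h * n + 0 * m = n * h by ring.
  by ring.
have lin k : is_derive (0 : R) 1 (fun h => k * h) k.
  by apply: is_derive_eq; rewrite /GRing.scale /= mulr1.
have He : is_derive (0 : R) 1 (expR \o (fun h => m * h)) (expR (m * 0) * m).
  exact: is_derive1_comp.
have Hc : is_derive (0 : R) 1 (cos \o (fun h => n * h)) (- sin (n * 0) * n).
  exact: is_derive1_comp.
have Hs : is_derive (0 : R) 1 (sin \o (fun h => n * h)) (cos (n * 0) * n).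
  exact: is_derive1_comp.
apply: is_derive_eq.
rewrite /GRing.scale /= !mulr0 expR0 sin0 cos0.
ring.
Qed.

Lemma is_derive_Re_sum_cexp (I : Type) (s : seq I) (c mu : I -> R[i]) :
  is_derive (0 : R) 1
    (fun h => complex.Re (\sum_(i <- s) c i * cexp (h%:C * mu i)))
    (complex.Re (\sum_(i <- s) c i * mu i)).
Proof.
elim: s => [|i s IH].
  rewrite big_nil; under eq_fun do rewrite big_nil.
  exact: is_derive_cst.
rewrite big_cons raddfD /=; under eq_fun do rewrite big_cons raddfD /=.
exact: is_deriveD (is_derive_Re_cexp _ _) IH.
Qed.

(** Multiplying the coefficients by [- 'i] turns statements about imaginary parts of exponential
    sums into those about real parts. *)
Lemma Im_Re z : complex.Im z = complex.Re (- 'i%C * z).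
Proof. by case: z => a b /=; ring. Qed.

Lemma is_derive_Im_sum_cexp (I : Type) (s : seq I) (c mu : I -> R[i]) :
  is_derive (0 : R) 1
    (fun h => complex.Im (\sum_(i <- s) c i * cexp (h%:C * mu i)))
    (complex.Im (\sum_(i <- s) c i * mu i)).
Proof.
rewrite Im_Re mulr_sumr.
under eq_fun do rewrite Im_Re mulr_sumr.
under eq_bigr do rewrite mulrA.
under eq_fun do under eq_bigr do rewrite mulrA.
exact: is_derive_Re_sum_cexp.
Qed.

Lemma cvg_complex (T : Type) (F : set_system T) (FF : Filter F)
    (f : T -> R[i]) (l : R[i]) :
  complex.Re (f x) @[x --> F] --> complex.Re l ->
  complex.Im (f x) @[x --> F] --> complex.Im l ->
  (f x : R[i]^o) @[x --> F] --> (l : R[i]^o).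
Proof.
move=> /cvgrPdist_lt fRe /cvgrPdist_lt fIm.
(* In the order on [R[i]], [0 < e] forces a zero imaginary part, so the radius is real and can be
   halved. *)
apply/cvgrPdist_lt => -[e e'] /=; rewrite ltcE /= => /andP[/eqP -> e0].
have e20 : 0 < e / 2 by rewrite divr_gt0.
near=> x.
rewrite [l - f x]complexE (le_lt_trans (ler_normD _ _))//.
rewrite normrM !normc_def /= !expr0n /= !add0r addr0 !expr1n !sqrtr1 !sqrtr_sqr.
rewrite addr0 sqrtr_sqr mul1r -rmorphD /= ltcR raddfB [X in _ + `|X|]raddfB.
rewrite [e]splitr ltrD//; near: x; [exact: fRe|exact: fIm].
Unshelve. all: by end_near. Qed.

Lemma cvg_sum_cexp (I : Type) (s : seq I) (c mu : I -> R[i]) :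
  ((\sum_(i <- s) c i * cexp (h%:C * mu i)) : R[i]^o) @[h --> (0 : R)]
    --> ((\sum_(i <- s) c i) : R[i]^o).
Proof.
have E : \sum_(i <- s) c i = \sum_(i <- s) c i * cexp (0%:C * mu i).
  by apply: eq_bigr => i _; rewrite mul0r cexp0 mulr1.
have cont (f : R -> R) d : is_derive (0 : R) 1 f d -> f h @[h --> 0] --> f 0.
  by move=> [df _]; apply: differentiable_continuous; apply/derivable1_diffP.
rewrite E; apply: cvg_complex.
  exact: (cont _ _ (is_derive_Re_sum_cexp s c mu)).
exact: (cont _ _ (is_derive_Im_sum_cexp s c mu)).
Qed.

End ComplexExponential.

(** A directional derivative depends only on the germ at [h = 0] of the restriction to the line
    through [y]. *)
Lemma is_derive_line (R : realType) (V W : normedModType R) (f : V -> W)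
    (y v : V) (g : R -> W) (d : W) :
  (\forall h \near (0 : R), f (y + h *: v) = g h) ->
  is_derive (0 : R) 1 g d -> is_derive y v f d.
Proof.
move=> fg dg.
have [D E] : is_derive (0 : R) 1 (fun h => f (h *: v + y)) d.
  by apply: near_eq_is_derive dg; apply: filterS fg => h fgh; rewrite addrC fgh.
apply: DeriveDef; first exact/derivable1P.
rewrite -E /derive; congr (lim _).
apply: (congr1 (fun u : R -> W => u @ (0 : R)^')); apply/funext => h /=.
by rewrite addr0 scale0r add0r scaler1.
Qed.

(** * Fractional parts near a point *)

Section FractionalParts.
Context {R : realType}.
Implicit Types (a k h : R).

Lemma frac_shift a h :
  (Num.floor a)%:~R <= a + h < (Num.floor a)%:~R + 1 ->
  Defs.frac (a + h) = Defs.frac a + h.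
Proof.
move=> ah; rewrite /Defs.frac (@floor_def _ _ (Num.floor a)) ?intrD//.
by rewrite addrAC.
Qed.

Lemma between_floor_notint a h :
  (Num.floor a)%:~R < a + h < (Num.floor a)%:~R + 1 ->
  a + h \isn't a Num.int.
Proof.
move=> /andP[lo up]; rewrite intrEfloor (@floor_def _ _ (Num.floor a)).
  by rewrite lt_eqF.
by rewrite intrD ltW.
Qed.

(** Non-integrality makes both inequalities strict at [h = 0], hence stable under small
    displacements of either sign. *)
Lemma near_between_floor a k : a \isn't a Num.int ->
  \forall h \near (0 : R),
    (Num.floor a)%:~R < a + h * k < (Num.floor a)%:~R + 1.
Proof.
rewrite intrEfloor => aNint.
have lo : (Num.floor a)%:~R < a by rewrite lt_neqAle aNint floor_le.
have up : a < (Num.floor a)%:~R + 1 by rewrite -[1]/(1%:~R) -intrD floorD1_gt.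
have cv : (a + h * k) @[h --> (0 : R)] --> a.
  rewrite -[X in _ --> X](addr0 a) -[X in _ + X](mul0r k).
  by apply: cvgD; [exact: cvg_cst|apply: cvgMl; exact: cvg_id].
near=> h; apply/andP; split; near: h.
- exact: (cvgr_gt _ cv).
- exact: (cvgr_lt _ cv).
Unshelve. all: by end_near. Qed.

(** Moving to the right leaves [floor a] strictly behind even when [a] is an integer; this is the
    source of the one-sided limit. *)
Lemma near_right_between_floor a k : 0 < k ->
  \forall h \near (0 : R)^'+,
    (Num.floor a)%:~R < a + h * k < (Num.floor a)%:~R + 1.
Proof.
move=> k0.
have lo : (Num.floor a)%:~R <= a by exact: floor_le.
have up : a < (Num.floor a)%:~R + 1 by rewrite -[1]/(1%:~R) -intrD floorD1_gt.
near=> h; have h0 : 0 < h by near: h; exact: nbhs_right_gt.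
apply/andP; split; first by rewrite (le_lt_trans lo)// ltrDl mulr_gt0.
rewrite -ltrBrDl -ltr_pdivlMr//; near: h; apply: nbhs_right_lt.
by rewrite divr_gt0// subr_gt0.
Unshelve. all: by end_near. Qed.

End FractionalParts.

Lemma filter_forall_seq (T : Type) (F : set_system T) {FF : Filter F}
    (I : eqType) (s : seq I) (P : I -> T -> Prop) :
  (forall i, i \in s -> \forall x \near F, P i x) ->
  \forall x \near F, forall i, i \in s -> P i x.
Proof.
elim: s => [|i s IH] Ps; first by apply: filterE.
have Pi := Ps i (mem_head _ _).
have {}IH := IH (fun j js => Ps j (mem_behead (s := i :: s) js)).
by apply: filterS2 Pi IH => x Pix Psx j; rewrite inE => /orP[/eqP ->|/Psx].
Qed.

(** * Dual bases and walls *)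

Section DualBasis.
Context {R : realType} {r : nat}.
Implicit Types (x y v : 'rV[R]_r) (B L : {fset elt R r}) (f g : elt R r).

Lemma dotp_is_linear v : linear (fun x => dotp x v : R^o).
Proof.
move=> a x y; rewrite /dotp scaler_sumr -big_split; apply: eq_bigr => i _.
by rewrite !mxE /GRing.scale /=; ring.
Qed.

Lemma dotpDl v x y : dotp (x + y) v = dotp x v + dotp y v.
Proof. by have := dotp_is_linear v 1 x y; rewrite !scale1r. Qed.

Lemma dotpZl v a x : dotp (a *: x) v = a * dotp x v.
Proof.
have := dotp_is_linear v a x 0; rewrite addr0 => ->.
by rewrite {2}/dotp big1 ?addr0// => i _; rewrite mxE mul0r.
Qed.

Lemma dotp_suml (I : Type) (s : seq I) (F : I -> 'rV[R]_r) v :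
  dotp (\sum_(i <- s) F i) v = \sum_(i <- s) dotp (F i) v.
Proof.
apply: (big_morph (fun x => dotp x v) (dotpDl v)).
by rewrite /dotp big1// => i _; rewrite mxE mul0r.
Qed.

Lemma dotp_delta j v : dotp (delta_mx 0 j) v = v 0 j.
Proof.
rewrite /dotp (bigD1 j)//= mxE !eqxx mul1r big1 ?addr0// => i ij.
by rewrite mxE (negbTE ij) mul0r.
Qed.

Lemma basesP {B L} : B \in bases L ->
  [/\ (B `<=` L)%fset, #|` B| = r & basis_of fullv (vecs B)].
Proof.
by rewrite !inE /= fpowersetE => /andP[BL /andP[/eqP cB bB]].
Qed.

Lemma dualP B L f g : B \in bases L -> f \in B -> g \in B ->
  dotp (vec g) (dual B f) = (g == f)%:R.
Proof.
move=> /basesP[_ _ bB] fB gB; rewrite /dual.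
(* The default value 0 of [xget] is excluded by a witness: the coordinate form of [f] in the basis
   [vecs B], represented by its values on the standard basis. *)
case: xgetP => [v -> /= -> //|/(_ (\row_j coord (in_tuple (vecs B))
  (cast_ord (esym (size_map _ _)) (Ordinal (etrans (index_mem f B) fB)))
  (delta_mx 0 j)))].
case=> h hB; set i := cast_ord _ _.
have ci x : dotp x (\row_j coord (in_tuple (vecs B)) i (delta_mx 0 j)) =
    coord (in_tuple (vecs B)) i x.
  rewrite {2}(row_sum_delta x) linear_sum; apply: eq_bigr => j _.
  by rewrite linearZ mxE.
rewrite ci.
have hi : (index h B < size (vecs B))%N by rewrite size_map index_mem.
have -> : vec h = (in_tuple (vecs B))`_(Ordinal hi).
  by rewrite /= (nth_map h) ?index_mem// nth_index.
rewrite coord_free ?(basis_free bB)//; congr (nat_of_bool _)%:R.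
(* Positions in [B] determine elements, so equality of indices is equality of [h] and [f]. *)
rewrite -val_eqE /=; apply/idP/idP => /eqP E; last by rewrite E.
by apply/eqP; rewrite -(nth_index f hB) E nth_index.
Qed.

Lemma perm_fsetD1 B f : f \in B ->
  perm_eq (enum_fset B) (f :: enum_fset (B `\ f)%fset).
Proof.
move=> fB; apply: uniq_perm => [||g]; first exact: fset_uniq.
  by rewrite /= fset_uniq !inE eqxx.
rewrite inE; have [->|gf] := eqVneq g f; first by rewrite fB.
by rewrite /= [RHS]in_fsetD1 gf.
Qed.

Lemma perm_vecsD1 B f : f \in B ->
  perm_eq (vecs B) (vec f :: vecs (B `\ f)%fset).
Proof. by move=> fB; rewrite /vecs (perm_map _ (perm_fsetD1 fB)). Qed.

Lemma wall_of_basis B L f : B \in bases L -> f \in B ->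
  (B `\ f)%fset \in walls L.
Proof.
move=> /basesP[BL cB bB] fB; rewrite !inE /= fpowersetE.
rewrite (fsubset_trans (fsubD1set _ _) BL) /=; apply/andP; split.
  by apply/eqP; rewrite -[RHS]cB (cardfsD1 f B) fB.
have := basis_free bB; rewrite (perm_free (perm_vecsD1 fB)) free_cons.
by case/andP.
Qed.

Lemma dotp_span_dual B L f x : B \in bases L -> f \in B ->
  x \in <<vecs (B `\ f)%fset>>%VS -> dotp x (dual B f) = 0.
Proof.
move=> BL fB; rewrite -[vecs _]/(tval (in_tuple _)) => /coord_span ->.
rewrite dotp_suml big1// => i _; rewrite dotpZl.
have /mapP[g] : (in_tuple (vecs (B `\ f)%fset))`_i \in vecs (B `\ f)%fset.
  by rewrite mem_nth.
rewrite /= in_fsetD1 => /andP[gf gB] ->.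
by rewrite (dualP BL)// (negbTE gf) mulr0.
Qed.

(** The pairing with [dual B f] is the coefficient of [vec f] in the expansion of [x] in the
    basis. *)
Lemma span_of_dotp_dual0 B L f x : B \in bases L -> f \in B ->
  dotp x (dual B f) = 0 -> x \in <<vecs (B `\ f)%fset>>%VS.
Proof.
move=> BL fB; have [_ _ bB] := basesP BL.
have : x \in <<vecs B>>%VS by rewrite (span_basis bB) memvf.
rewrite (eq_span (perm_mem (perm_vecsD1 fB))) span_cons.
move=> /memv_addP[_ /vlineP[k ->] [z zS ->]].
rewrite dotpDl dotpZl (dualP BL)// eqxx mulr1 (dotp_span_dual BL fB zS) addr0.
by move=> ->; rewrite scale0r add0r.
Qed.

(** If the pairing were an integer [n], then [y + w - n f] would lie in the wall spanned by the rest
    of [B], and [y] in a lattice translate of that wall. *)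
Lemma dotp_dual_notint B L f y (w : 'rV[int]_r) : B \in bases L -> f \in B ->
  ~ hyperplanes L y -> dotp (y + toV R w) (dual B f) \isn't a Num.int.
Proof.
move=> BL fB yL; apply/negP => /intrP[n yn]; apply: yL.
exists (B `\ f)%fset, (n *: f.1 - w); split; first exact: wall_of_basis.
apply: (span_of_dotp_dual0 BL fB).
have -> : y - toV R (n *: f.1 - w) = (y + toV R w) + (- n%:~R) *: vec f.
  by apply/rowP => i; rewrite !mxE rmorphB rmorphM /=; ring.
by rewrite dotpDl yn dotpZl (dualP BL)// eqxx mulr1 subrr.
Qed.

Lemma dotp_dual_neq0 B L f phi : phi_regular L phi -> B \in bases L -> f \in B ->
  dotp phi (dual B f) != 0.
Proof.
move=> phiL BL fB; apply: contra (phiL _ (wall_of_basis BL fB)) => /eqP.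
exact: span_of_dotp_dual0 BL fB.
Qed.

End DualBasis.

(** * Terms of the bases under displacement of [y] *)

Section BasisTerms.
Context {R : realType} {r : nat}.
Implicit Types (y v phi : 'rV[R]_r) (B L : {fset elt R r}) (f g : elt R r).
Implicit Types (t : elt R r -> R[i]) (a : {fset elt R r} -> R[i]) (h : R).

(** The part of the term of [B] that varies with [y]; it involves [B] but not [L], so it is common
    to the sums for [L] and [L']. *)
Definition basis_term phi t B y : R[i] :=
  (#|` lquot B|)%:R^-1
  * \sum_(C <- enum_fset (lquot B))
      \prod_(f <- enum_fset B)
        (t f * cexp (tshift t f
                     * (fracB phi B f (y + toV R (coset_rep C)))%:C)
         / (cexp (tshift t f) - 1)).

(** The exponential rate of [basis_term] along [v]; at [v = vec g] it is the sum subtracted in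
    [linden t B g]. *)
Definition growth t B v : R[i] :=
  \sum_(f <- enum_fset B) tshift t f * (dotp v (dual B f))%:C.

Lemma growthE t B v :
  growth t B v = \sum_(j < r) (v 0 j)%:C * growth t B (delta_mx 0 j).
Proof.
rewrite /growth; under [RHS]eq_bigr do rewrite mulr_sumr.
rewrite exchange_big /=; apply: eq_bigr => f _.
rewrite {1}/dotp rmorph_sum mulr_sumr /=; apply: eq_bigr => j _.
by rewrite dotp_delta rmorphM mulrCA.
Qed.

(** By duality only [f = g] contributes to the sum, and its contribution is [tshift t g]. *)
Lemma linden_basis0 t B L g : B \in bases L -> g \in B -> linden t B g = 0.
Proof.
move=> BL gB; rewrite /linden (perm_big _ (perm_fsetD1 gB)) big_cons /=.
rewrite (dualP BL)// eqxx mulr1 big_seq big1 ?addr0 ?subrr// => f.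
rewrite /= in_fsetD1 => /andP[fg fB].
by rewrite (dualP BL)// eq_sym (negbTE fg) mulr0.
Qed.

Definition fracB_affine phi v h B f y : Prop :=
  fracB phi B f (y + h *: v) = fracB phi B f y + h * dotp v (dual B f).

Lemma near_fracB_affine phi v B f y : dotp y (dual B f) \isn't a Num.int ->
  \forall h \near (0 : R), fracB_affine phi v h B f y.
Proof.
move=> yN; rewrite /fracB_affine /fracB; case: ifPn => _.
  apply: filterS (near_between_floor (dotp v (dual B f)) yN) => h /andP[lo up].
  by rewrite dotpDl dotpZl frac_shift// ltW.
rewrite -rpredN in yN.
apply: filterS (near_between_floor (- dotp v (dual B f)) yN) => h /andP[lo up].
rewrite dotpDl dotpZl [- (_ + _ * _)]opprD -mulrN frac_shift ?ltW//.
by rewrite mulrN opprD opprK addrA.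
Qed.

(** The branch of [fracB] follows the sign of the pairing of [phi], so the argument of [frac] always
    increases along [phi], and [frac] does not jump on the right of an integer. *)
Lemma near_right_fracB_affine phi B f y : dotp phi (dual B f) != 0 ->
  \forall h \near (0 : R)^'+, fracB_affine phi phi h B f y.
Proof.
rewrite /fracB_affine /fracB => phi0; case: ifPn => phiB.
  apply: filterS (near_right_between_floor (dotp y (dual B f)) phiB).
  by move=> h /andP[lo up]; rewrite dotpDl dotpZl frac_shift// ltW.
have phiB' : 0 < - dotp phi (dual B f).
  by rewrite oppr_gt0 lt_neqAle phi0 leNgt.
apply: filterS (near_right_between_floor (- dotp y (dual B f)) phiB').
move=> h /andP[lo up].
rewrite dotpDl dotpZl [- (_ + _ * _)]opprD -mulrN frac_shift ?ltW//.
by rewrite mulrN opprD opprK addrA.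
Qed.

(** The increments of the fractional parts do not depend on the coset, so the same exponential
    factors out of every summand. *)
Lemma basis_term_shift phi t B y v h :
  (forall f C, f \in B -> C \in lquot B ->
     fracB_affine phi v h B f (y + toV R (coset_rep C))) ->
  basis_term phi t B (y + h *: v) =
  basis_term phi t B y * cexp (h%:C * growth t B v).
Proof.
move=> aff; rewrite /basis_term -mulrA mulr_suml; congr (_ * _).
apply: eq_big_seq => C CB; rewrite /growth mulr_sumr cexp_sum -big_split /=.
apply: eq_big_seq => f fB; rewrite addrAC aff// rmorphD mulrDr cexpD rmorphM.
by rewrite [h%:C * (_ * _)]mulrCA [RHS]mulrAC !mulrA.
Qed.

(** Only finitely many triples [B], [f], [C] occur, and a filter is closed under finite
    intersections. *)
Lemma near_bases (T : Type) (F : set_system T) {FF : Filter F} L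
    (P : forall B f, set 'rV[int]_r -> T -> Prop) :
  (forall B f C, B \in bases L -> f \in B -> C \in lquot B ->
     \forall x \near F, P B f C x) ->
  \forall x \near F, forall B f C, B \in bases L -> f \in B -> C \in lquot B ->
     P B f C x.
Proof.
move=> PF.
have H : \forall x \near F, forall B, B \in enum_fset (bases L) ->
    forall f, f \in enum_fset B -> forall C, C \in enum_fset (lquot B) ->
    P B f C x.
  by do 3!(apply: filter_forall_seq => ? ?); exact: PF.
by apply: filterS H => x Px B f C BL fB CB; exact: Px.
Qed.

(* Unlike the complement of [hyperplanes L], which it contains, this set is cut
   out by finitely many conditions, so that it is visibly open along lines. *)
Definition regular_points L : set 'rV[R]_r :=
  [set y | forall B f C, B \in bases L -> f \in B -> C \in lquot B ->
     dotp (y + toV R (coset_rep C)) (dual B f) \isn't a Num.int].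

Lemma hyperplanesC_regular L : ~` hyperplanes L `<=` regular_points L.
Proof. by move=> y yL B f C BL fB _; exact: dotp_dual_notint BL fB yL. Qed.

Lemma near_regular_points L y v : regular_points L y ->
  \forall h \near (0 : R), regular_points L (y + h *: v).
Proof.
move=> yL; apply: (@near_bases _ (nbhs (0 : R)) _ L (fun B f C h => dotp
  (y + h *: v + toV R (coset_rep C)) (dual B f) \isn't a Num.int)).
move=> B f C BL fB CB.
apply: filterS (near_between_floor (dotp v (dual B f)) (yL _ _ _ BL fB CB)) => h.
by move=> /between_floor_notint; rewrite addrAC [in X in _ -> X]dotpDl dotpZl.
Qed.

(** Each pairing moves along [phi] with nonzero speed, so it leaves the integers at once, even if
    [y] lies on a hyperplane. *)
Lemma near_right_regular_points L y phi : phi_regular L phi ->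
  \forall h \near (0 : R)^'+, regular_points L (y + h *: phi).
Proof.
move=> phiL; apply: (@near_bases _ (0 : R)^'+ _ L (fun B f C h => dotp
  (y + h *: phi + toV R (coset_rep C)) (dual B f) \isn't a Num.int)).
move=> B f C BL fB CB.
set a := dotp (y + toV R (coset_rep C)) (dual B f).
have := dotp_dual_neq0 phiL BL fB.
rewrite neq_lt => /orP[phi0|phi0].
  rewrite -oppr_gt0 in phi0.
  apply: filterS (near_right_between_floor (- a) phi0) => h.
  move=> /between_floor_notint.
  by rewrite mulrN -opprD rpredN addrAC [in X in _ -> X]dotpDl dotpZl.
apply: filterS (near_right_between_floor a phi0) => h /between_floor_notint.
by rewrite addrAC [in X in _ -> X]dotpDl dotpZl.
Qed.

(** The coefficients [a] are arbitrary so that, at regular points, each [Dop] changes only [a]. *)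
Definition basis_sum phi t L a y : R[i] :=
  \sum_(B <- enum_fset (bases L)) a B * basis_term phi t B y.

Lemma basis_sum_shift phi t L a y v h :
  (forall B f C, B \in bases L -> f \in B -> C \in lquot B ->
     fracB_affine phi v h B f (y + toV R (coset_rep C))) ->
  basis_sum phi t L a (y + h *: v) =
  \sum_(B <- enum_fset (bases L))
    a B * basis_term phi t B y * cexp (h%:C * growth t B v).
Proof.
move=> aff; apply: eq_big_seq => B BL.
by rewrite basis_term_shift ?mulrA// => f C; exact: aff.
Qed.

Lemma near_basis_sum phi t L a y v : regular_points L y ->
  \forall h \near (0 : R), basis_sum phi t L a (y + h *: v) =
  \sum_(B <- enum_fset (bases L))
    a B * basis_term phi t B y * cexp (h%:C * growth t B v).
Proof.
move=> yL.
have H : \forall h \near (0 : R), forall B f C,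
    B \in bases L -> f \in B -> C \in lquot B ->
    fracB_affine phi v h B f (y + toV R (coset_rep C)).
  apply: (@near_bases _ (nbhs (0 : R)) _ L (fun B f C h =>
    fracB_affine phi v h B f (y + toV R (coset_rep C)))) => B f C BL fB CB.
  by apply: near_fracB_affine; exact: yL.
by apply: filterS H => h; exact: basis_sum_shift.
Qed.

(** For small [h > 0] the values form an exponential sum in [h] which is continuous at 0 and takes
    there the value at [y] itself. *)
Lemma basis_sum_cvg phi t L a y :
  (forall B f, B \in bases L -> f \in B -> dotp phi (dual B f) != 0) ->
  (basis_sum phi t L a (y + h *: phi) : R[i]^o) @[h --> (0 : R)^'+]
    --> (basis_sum phi t L a y : R[i]^o).
Proof.
move=> phiL.
have H : \forall h \near (0 : R)^'+, forall B f C,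
    B \in bases L -> f \in B -> C \in lquot B ->
    fracB_affine phi phi h B f (y + toV R (coset_rep C)).
  apply: (@near_bases _ (0 : R)^'+ _ L (fun B f C h =>
    fracB_affine phi phi h B f (y + toV R (coset_rep C)))) => B f C BL fB CB.
  by apply: near_right_fracB_affine; exact: phiL.
have cv := cvg_at_right_filter (@cvg_sum_cexp _ _ (enum_fset (bases L))
  (fun B => a B * basis_term phi t B y) (fun B => growth t B phi)).
apply: cvg_trans cv.
apply: near_eq_cvg; apply: filterS H => h aff.
by rewrite -basis_sum_shift.
Qed.

(** * Partial derivatives and the action of one operator *)

Section PartialDerivatives.
Variables (phi y : 'rV[R]_r) (t : elt R r -> R[i]) (L : {fset elt R r}).
Variables (a : {fset elt R r} -> R[i]) (F : 'rV[R]_r -> R[i]).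
Hypothesis yL : regular_points L y.
(** Agreement is assumed at regular points only, since this is what induction provides for an
    iterated [Dprod]; it suffices because points near [y] on a line are regular. *)
Hypothesis FE : forall x, regular_points L x -> F x = basis_sum phi t L a x.

Let near_FE v : \forall h \near (0 : R), F (y + h *: v) =
  \sum_(B <- enum_fset (bases L))
    a B * basis_term phi t B y * cexp (h%:C * growth t B v).
Proof.
apply: filterS2 (near_regular_points v yL) (near_basis_sum phi t a v yL).
by move=> h /FE ->.
Qed.

Let is_derive_Re_F v : is_derive y v (fun x => complex.Re (F x))
  (complex.Re (\sum_(B <- enum_fset (bases L))
    a B * basis_term phi t B y * growth t B v)).
Proof.
apply: is_derive_line (is_derive_Re_sum_cexp _ _ _).
by apply: filterS (near_FE v) => h ->.
Qed.

Let is_derive_Im_F v : is_derive y v (fun x => complex.Im (F x))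
  (complex.Im (\sum_(B <- enum_fset (bases L))
    a B * basis_term phi t B y * growth t B v)).
Proof.
apply: is_derive_line (is_derive_Im_sum_cexp _ _ _).
by apply: filterS (near_FE v) => h ->.
Qed.

Lemma basis_sum_pderivable j : pderivable F y j.
Proof. by split; apply: ex_derive. Qed.

Lemma partial_basis_sum v : partial v F y =
  \sum_(B <- enum_fset (bases L)) a B * basis_term phi t B y * growth t B v.
Proof.
have eta (z : R[i]) : (complex.Re z +i* complex.Im z) = z by case: z.
have pE j : pderiv j F y = \sum_(B <- enum_fset (bases L))
    a B * basis_term phi t B y * growth t B (delta_mx 0 j).
  rewrite /pderiv.
  by case: (is_derive_Re_F (delta_mx 0 j)) (is_derive_Im_F (delta_mx 0 j)) =>
    _ -> [_ ->]; exact: eta.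
rewrite /partial; under eq_bigr do rewrite pE mulr_sumr.
rewrite exchange_big /=; apply: eq_bigr => B _.
by rewrite [growth t B v]growthE mulr_sumr; apply: eq_bigr => j _; rewrite mulrCA.
Qed.

(** Differentiation along [vec g] multiplies the term of [B] by [growth t B (vec g)], and
    [tshift t g] minus this rate is [linden t B g]. *)
Lemma Dop_basis_sum g : Dop t g F y =
  basis_sum phi t L (fun B => linden t B g / t g * a B) y.
Proof.
rewrite /Dop partial_basis_sum FE// /basis_sum !mulr_sumr -sumrB.
by apply: eq_bigr => B _; rewrite /linden -/(growth t B (vec g)); ring.
Qed.

End PartialDerivatives.

(** * Products of operators and cancellation of the factors *)

Lemma genF_basis_sum phi L t : genF phi L t =
  basis_sum phi t L
    (fun B => \prod_(g <- enum_fset (L `\` B)%fset) (t g / linden t B g)).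
Proof. by []. Qed.

Lemma Dprod_basis_sum phi t L a s y : regular_points L y ->
  Dprod t s (basis_sum phi t L a) y =
  basis_sum phi t L (fun B => (\prod_(g <- s) (linden t B g / t g)) * a B) y.
Proof.
elim: s y => [|g s IH] y yL /=.
  by apply: eq_bigr => B _; rewrite big_nil mul1r.
rewrite (Dop_basis_sum yL IH); apply: eq_bigr => B _.
by rewrite big_cons !mulrA.
Qed.

Lemma Dprod_defined_basis_sum phi t L a s (U : set 'rV[R]_r) :
  U `<=` regular_points L -> Dprod_defined t U s (basis_sum phi t L a).
Proof.
move=> UL; elim: s => //= g s IH; split=> // y j /UL yL.
by apply: basis_sum_pderivable yL _ _ => x xL; exact: Dprod_basis_sum.
Qed.

Lemma bases_sub L L' : (L' `<=` L)%fset ->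
  bases L' = [fset B in bases L | (B `<=` L')%fset]%fset.
Proof.
move=> L'L; apply/fsetP => B; rewrite !inE /= !fpowersetE.
have [BL'|_] := boolP (B `<=` L')%fset; last by rewrite andbF.
by rewrite (fsubset_trans BL' L'L) andbT.
Qed.

Lemma basis_sum_reduce phi L L' t s y : (L' `<=` L)%fset ->
  t_regular L t -> (forall g, g \in (L `\` L')%fset -> t g != 0) ->
  perm_eq s (enum_fset (L `\` L')%fset) ->
  basis_sum phi t L (fun B => (\prod_(g <- s) (linden t B g / t g))
    * \prod_(g <- enum_fset (L `\` B)%fset) (t g / linden t B g)) y =
  genF phi L' t y.
Proof.
move=> L'L [_ tL] t0 sE; rewrite genF_basis_sum /basis_sum (bases_sub L'L).
(* The sum over [bases L'] is extended to [bases L], with zero terms for bases not contained in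
   [L']. *)
rewrite -[RHS]big_fset_condE [RHS]big_mkcond /=; apply: eq_big_seq => B BL.
have [BsL _ _] := basesP BL.
(* A basis not contained in [L'] has an element [g] in [s], whose factor vanishes. *)
case: ifPn => [BL'|/fsubsetPn[g gB gL']]; last first.
  rewrite (perm_big _ sE) /= (big_rem g) /=.
    by rewrite (linden_basis0 t BL gB) !mul0r.
  by rewrite in_fsetD gL' (fsubsetP BsL).
congr (_ * _).
(* For [B] inside [L'], the complement of [B] in [L] is the disjoint union of [s] and the complement
   of [B] in [L']; the factors over [s] cancel. *)
have -> : \prod_(g <- enum_fset (L `\` B)%fset) (t g / linden t B g) =
    \prod_(g <- s) (t g / linden t B g) *
    \prod_(g <- enum_fset (L' `\` B)%fset) (t g / linden t B g).
  rewrite -big_cat; apply: perm_big; apply: uniq_perm => [||g] /=.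
  - exact: fset_uniq.
  - rewrite cat_uniq (perm_uniq sE) !fset_uniq /= andbT; apply/hasPn => g /=.
    by rewrite (perm_mem sE) /= !in_fsetD => /andP[_ ->].
  - rewrite mem_cat (perm_mem sE) /= !in_fsetD.
    have [gL'|gL'] /= := boolP (g \in L'); first by rewrite (fsubsetP L'L) ?andbT.
    rewrite andbF orbF; have [gB|//] := boolP (g \in B).
    by rewrite (fsubsetP BL' _ gB) in gL'.
rewrite mulrA -big_split /= big_seq big1 ?mul1r// => g.
rewrite (perm_mem sE) => gLL'.
have tg := t0 g gLL'; have : linden t B g != 0.
  apply: tL => //; move: gLL'; rewrite /= !in_fsetD => /andP[gL' ->].
  by rewrite andbT; apply: contra gL' => /(fsubsetP BL').
by move=> lg; rewrite mulrA divfK// divff.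
Qed.

End BasisTerms.

(** * The identity off the hyperplanes and its extension along [phi] *)

Theorem theorem9p1 (R : realType) (r : nat) (L L' : {fset elt R r})
    (phi : 'rV[R]_r) (t : elt R r -> R[i]) (s : seq (elt R r)) :
  admissible L -> admissible L' -> (L' `<=` L)%fset ->
  phi_regular L phi ->
  t_regular L t ->
  (forall g, g \in (L `\` L')%fset -> t g != 0) ->
  perm_eq s (enum_fset (L `\` L')%fset) ->
  [/\ Dprod_defined t (~` hyperplanes L) s (genF phi L t),
      (forall y, ~ hyperplanes L y ->
         Dprod t s (genF phi L t) y = genF phi L' t y)
    & (forall y : 'rV[R]_r,
         (Dprod t s (genF phi L t) (y + c *: phi) : R[i]^o) @[c --> 0^'+]
           --> (genF phi L' t y : R[i]^o))].
Proof.
move=> _ _ L'L phiL tL t0 sE.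
have DE y : regular_points L y -> Dprod t s (genF phi L t) y = genF phi L' t y.
  by move=> yL; rewrite Dprod_basis_sum// (basis_sum_reduce _ _ L'L).
split.
- rewrite genF_basis_sum; apply: Dprod_defined_basis_sum.
  exact: hyperplanesC_regular.
- by move=> y /hyperplanesC_regular; exact: DE.
- move=> y.
  have cv : (genF phi L' t (y + c *: phi) : R[i]^o) @[c --> (0 : R)^'+]
      --> (genF phi L' t y : R[i]^o).
    apply: basis_sum_cvg => B f; rewrite (bases_sub L'L).
    move=> /imfsetP[/= {}B /andP[BL _] ->] fB.
    exact: dotp_dual_neq0 phiL BL fB.
  (* Points [y + c phi] with small [c > 0] are regular, so [DE] transfers the limit from [L']. *)
  apply: cvg_trans cv; apply: near_eq_cvg.
  apply: filterS (near_right_regular_points y phiL) => c yc.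
  by rewrite DE.
Qed.
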